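(* Let $T=(V,E)$ be a combinatorial tree and let $i\in V$ be fixed. Then $$2\sum_{j\in V}\Delta(i,j)=\frac12\operatorname{vol}(T)+\sum_{j\in V}\Delta(i,j)\,\mathrm{d}(j).$$
   Context: A tree is a finite, simple, connected, acyclic graph; a combinatorial tree is a tree with all edge weights equal to one. $\mathrm{d}(j)$ is the degree of $j$ (number of incident edges), $\Delta(i,j)$ is the shortest path distance (number of edges in a shortest path), and, since all weights are one, the volume is $\operatorname{vol}(T)=\sum_{j\in V}\mathrm{d}(j)$. *)

(* Defs.v *)
From HB Require Import structures.
From mathcomp Require Import all_boot all_order all_algebra.

Set Implicit Arguments.
Unset Strict Implicit.
Unset Printing Implicit Defensive.

Import Order.TTheory GRing.Theory Num.Theory.

(* A graph on the finite type V is given by its adjacency relation e. *)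

Definition simple_graph (V : finType) (e : rel V) : Prop :=
  symmetric e /\ irreflexive e.

Definition connected_graph (V : finType) (e : rel V) : Prop :=
  forall x y : V, connect e x y.

(* The bound on the size is needed: in a simple graph, [:: x; y] with x and y
   adjacent satisfies ucycle e (it runs twice along the same edge). *)
Definition acyclic_graph (V : finType) (e : rel V) : Prop :=
  forall c : seq V, 2 < size c -> ~ ucycle e c.

Definition is_tree (V : finType) (e : rel V) : Prop :=
  [/\ simple_graph e, connected_graph e & acyclic_graph e].

Definition edges (V : finType) (e : rel V) : {set {set V}} :=
  [set [set p.1; p.2] | p : V * V & e p.1 p.2].

Definition degree (V : finType) (e : rel V) (j : V) : nat :=
  #|[set f in edges e | j \in f]|.

Definition volume (V : finType) (e : rel V) : nat := \sum_(j : V) degree e j.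

(* x :: p is the vertex sequence of a path, so size p is its number of edges. *)
Definition has_path_of_length (V : finType) (e : rel V) (x y : V) (n : nat) :
    bool :=
  [exists p : n.-tuple V, [&& path e x p, uniq (x :: p) & last x p == y]].

(* A path has fewer than #|V| edges since its vertices are distinct; find
   returns the least admissible length, and #|V| when no path exists (which
   does not happen in a connected graph). *)
Definition distance (V : finType) (e : rel V) (x y : V) : nat :=
  find (has_path_of_length e x y) (iota 0 #|V|).

(* Main.v *)
Require Import Defs.
From HB Require Import structures.
From mathcomp Require Import all_boot all_order all_algebra.
From mathcomp Require Import zify ring lra.

Set Implicit Arguments.
Unset Strict Implicit.
Unset Printing Implicit Defensive.

Import Order.TTheory GRing.Theory Num.Theory.

(** Root the tree at i and write D x for the distance from i to x.  Along an
    edge D changes by exactly one, and every vertex x other than i has exactly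
    one neighbour nearer to i, its parent.  Twice the right-hand side is the
    sum of 1 + 2 D x over all ordered pairs of adjacent vertices (x, y).  The
    two orientations of the edge from x to its parent contribute together
    (1 + 2 D x) + (1 + 2 (D x - 1)) = 4 D x, and each edge joins exactly one
    vertex to its parent, so the total is four times the sum of the D x; the
    root, which has no parent, adds nothing because D i = 0.

    The two facts on D rest on the uniqueness of the simple path between two
    vertices of a forest ([simple_path_unique]): it identifies D x with the
    length of any simple path from i to x ([distance_path]), and adjacent
    vertices x and y then satisfy a dichotomy, namely that the simple path to
    one of them extends by the edge to the simple path to the other
    ([adjacent_path_extension]). *)

Local Open Scope nat_scope.

Lemma card_sum_nat (T : finType) (P : pred T) : #|P| = \sum_x P x.
Proof.
rewrite -sum1_card big_mkcond /=.
by apply: eq_bigr => x _; rewrite unfold_in; case: (P x).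
Qed.

Section Forest.

Variables (V : finType) (e : rel V).
Hypotheses (e_sym : symmetric e) (e_irr : irreflexive e).

(** The map sending a neighbour y of j to the edge {j, y} is a bijection onto
    the edges at j; it is injective because j is not its own neighbour. *)
Lemma degree_neighbours (j : V) : degree e j = #|[set y | e j y]|.
Proof.
rewrite /degree -(card_in_imset (f := fun y => [set j; y])); last first.
  move=> y z; rewrite !inE => jy jz /setP/(_ y).
  rewrite !inE eqxx orbT => /esym/orP[]/eqP // yj.
  by rewrite yj e_irr in jy.
congr #|pred_of_set _|; apply/setP=> f; rewrite !inE.
apply/andP/imsetP => [[/imsetP[[a b] /=]]|[y]]; rewrite inE /=.
  move=> ab ->; rewrite !inE => /orP[]/eqP->; first by exists b; rewrite ?inE.
  by exists a; rewrite ?inE 1?e_sym // setUC.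
move=> jy ->; rewrite !inE eqxx; split=> //.
by apply/imsetP; exists (j, y); rewrite ?inE.
Qed.

Hypothesis e_acyclic : acyclic_graph e.

(** Discard the common initial segment of the two paths.  If they then part at
    x, follow the first one up to the first vertex z that it shares with the
    second one, and return from z to x along the second one: this is a cycle,
    of length at least three because the two paths leave x by distinct
    edges. *)
Lemma simple_path_unique (x : V) (p q : seq V) :
  path e x p -> uniq (x :: p) -> path e x q -> uniq (x :: q) ->
  last x p = last x q -> p = q.
Proof.
elim: p x q => [|a p IHp] x [|b q] //.
- by move=> _ _ _ /= /andP[xq _] xE; rewrite xE mem_last in xq.
- by move=> _ /= /andP[xp _] _ _ xE; rewrite -xE mem_last in xp.
have [<- /= /andP[_ ep] /andP[_ up] /andP[_ eq] /andP[_ uq] l|nab] :=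
  eqVneq a b.
  by rewrite (IHp a q).
move=> ep up eq uq lE; exfalso.
have hasq: has (mem (b :: q)) (a :: p).
  have {}lE : last a p = last b q := lE; apply/hasP.
  exists (last a p); first exact: mem_last.
  by rewrite lE; exact: mem_last.
have hQ : ohead (b :: q) = Some b by [].
have hP : ohead (a :: p) = Some a by [].
move: (b :: q) (a :: p) hQ hP hasq ep up eq uq {lE}.
move=> Q P hQ hP hasq eP uP eQ uQ.
case: (split_find hasq) hP eP uP => z p1 p2 zQ disj hP eP uP.
case/splitPr: zQ disj hQ eQ uQ => q1 q2 disj hQ eQ uQ.
have ez1 : path e x (rcons p1 z) by move: eP; rewrite cat_path => /andP[].
have ez2 : path e x (rcons q1 z).
  by move: eQ; rewrite -cat_rcons cat_path => /andP[].
(* If both p1 and q1 were empty, then a = z = b. *)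
have sz : 0 < size p1 + size q1.
  case: p1 q1 hP hQ {disj eP uP eQ uQ ez1 ez2} => [|? ?] [|? ?] //= [->] [zb].
  by rewrite zb eqxx in nab.
apply: (e_acyclic (c := x :: p1 ++ z :: rev q1)).
  by rewrite /= size_cat /= size_rev addnS !ltnS.
apply/andP; split.
  rewrite /= rcons_cat -cat_rcons cat_path ez1 last_rcons /=.
  have := rev_path e x (rcons q1 z); rewrite last_rcons belast_rcons rev_cons.
  move=> ->; rewrite (eq_path (e' := e)) // => u v; exact: e_sym.
have uz1 : uniq (x :: rcons p1 z).
  by move: uP; rewrite -cat_cons cat_uniq => /andP[].
have uz2 : uniq (x :: rcons q1 z).
  by move: uQ; rewrite -cat_rcons -cat_cons cat_uniq => /andP[].
move: uz1 uz2; rewrite !cons_uniq !rcons_uniq !mem_rcons !inE !negb_or.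
move=> /and3P[/andP[xz xp1] zp1 up1] /and3P[/andP[_ xq1] zq1 uq1].
rewrite mem_cat inE mem_rev !negb_or xz xp1 xq1 cat_uniq up1 /=.
rewrite mem_rev zq1 rev_uniq uq1 negb_or zp1 !andbT /=.
apply/hasPn=> w; rewrite mem_rev => wq; apply: contra disj => wp.
by apply/hasP; exists w => //; rewrite /= mem_cat wq.
Qed.

(** By uniqueness all simple paths from x to y have the same length, so the
    minimum over them is reached by any. *)
Lemma distance_path (x : V) (p : seq V) :
  path e x p -> uniq (x :: p) -> distance e x (last x p) = size p.
Proof.
move=> ep up; have szp : size p < #|V|.
  by rewrite -[(size p).+1]/(size (x :: p)) -(card_uniqP up) max_card.
rewrite /distance (eq_find (a2 := pred1 (size p))) => [|n /=].
  have := index_uniq 0 (s := iota 0 #|V|) (i := size p).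
  by rewrite size_iota nth_iota // add0n; apply; rewrite ?iota_uniq.
apply/existsP/eqP => [[q /and3P[eq uq /eqP lq]]|->].
  by rewrite -(size_tuple q) (simple_path_unique eq uq ep up lq).
by exists (in_tuple p); rewrite ep up eqxx.
Qed.

(** If y already lies on the simple path to x, then cutting this path at y and
    adding the edge to x gives a simple path to x, hence the same path. *)
Lemma adjacent_path_extension (r x y : V) (p : seq V) :
  path e r p -> uniq (r :: p) -> last r p = x -> e x y ->
  uniq (r :: rcons p y) \/
  exists q, [/\ p = rcons q x & last r q = y].
Proof.
move=> ep up lp exy; case: (boolP (y \in r :: p)) => yp; last first.
  by left; rewrite -rcons_cons rcons_uniq yp.
right; have nyx : y != x by apply: contraTneq exy => ->; rewrite e_irr.
case/splitPl: yp ep up lp => p1 p2 ly.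
rewrite cat_path -cat_cons cat_uniq last_cat => /andP[ep1 ep2].
move=> /and3P[up1 dj up2] lx.
have xp2 : x \in p2.
  by have := mem_last (last r p1) p2; rewrite lx inE ly eq_sym (negPf nyx).
exists p1; split=> //.
apply: (@simple_path_unique r); rewrite ?last_cat ?last_rcons //.
- by rewrite cat_path ep1.
- by rewrite -cat_cons cat_uniq up1 dj.
- by rewrite rcons_path ep1 ly e_sym.
- by rewrite -rcons_cons rcons_uniq up1 andbT (hasPn dj).
Qed.

Hypothesis e_connected : connected_graph e.

Lemma simple_path_exists (x y : V) :
  exists p, [/\ path e x p, uniq (x :: p) & last x p = y].
Proof.
have /connectP[p ep ->] := e_connected x y.
by case/shortenP: ep => q eq uq _; exists q.
Qed.

Variable i : V.
Let D := distance e i.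

Definition parent (x y : V) : bool := e x y && (D x == (D y).+1).

(** By the dichotomy, the simple path to one of x and y is the simple path to
    the other with one more edge; in particular adjacent vertices are never
    equidistant from the root (a tree is bipartite). *)
Lemma adjacent_parent (x y : V) : e x y = parent x y (+) parent y x.
Proof.
rewrite /parent (e_sym y x); case exy: (e x y) => //=.
have [p [ep up lp]] := simple_path_exists i x.
have Dx : D x = size p by rewrite -lp; apply: distance_path.
have [uy|[q [pE lq]]] := adjacent_path_extension ep up lp exy.
  have Dy : D y = (size p).+1.
    rewrite -(size_rcons p y) -(distance_path (x := i)) ?last_rcons //.
    by rewrite rcons_path ep lp.
  lia.
have Dy : D y = size q.
  rewrite -lq; move: ep up; rewrite pE -rcons_cons rcons_uniq rcons_path.
  by move=> /andP[eq _] /andP[_ uq]; apply: distance_path.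
move: Dx; rewrite pE size_rcons; lia.
Qed.

(** The last vertex but one on the simple path from the root to x is a parent
    of x.  It is the only one: for any other neighbour y of x, the dichotomy
    makes the path to y pass through x, so that y is farther than x. *)
Lemma card_parent (x : V) : #|parent x| = (0 < D x).
Proof.
have [p [ep up lp]] := simple_path_exists i x.
have Dx : D x = size p by rewrite -lp; apply: distance_path.
rewrite Dx; case/lastP: p ep up lp Dx => [|q z] ep up lp Dx.
  by apply: eq_card0 => y; rewrite inE unfold_in /parent Dx /= andbF.
rewrite last_rcons in lp; subst z; rewrite size_rcons in Dx *.
apply: (eq_card1 (x := last i q)) => y; rewrite inE unfold_in.
have [eq exq] : path e i q /\ e x (last i q).
  by move: ep; rewrite rcons_path e_sym => /andP[].
have uq : uniq (i :: q) by move: up; rewrite -rcons_cons rcons_uniq => /andP[].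
rewrite /parent Dx; apply/andP/eqP => [[exy /eqP[Dy]]|->]; last first.
  by rewrite exq /D distance_path.
have [uy|[q' [/rcons_inj[<-] //]]] :=
  adjacent_path_extension ep up (last_rcons _ _ _) exy.
move: Dy; rewrite /D -{1}[y](last_rcons i (rcons q x)) distance_path //.
  by rewrite !size_rcons; lia.
by rewrite rcons_path ep last_rcons.
Qed.

(** Summing over ordered adjacent pairs and grouping the two orientations of
    each edge at its endpoint farther from the root turns the left-hand side
    into a sum over pairs of a child and its parent. *)
Lemma sum_distance_degree :
  \sum_(j : V) degree e j + 2 * \sum_(j : V) D j * degree e j =
  4 * \sum_(j : V) D j.
Proof.
rewrite !big_distrr -big_split /=.
transitivity (\sum_x \sum_y (parent x y * (1 + 2 * D x)
                             + parent y x * (1 + 2 * D x))).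
  apply: eq_bigr => x _.
  have -> : degree e x = \sum_y e x y.
    by rewrite degree_neighbours cardsE card_sum_nat.
  transitivity ((\sum_y e x y) * (1 + 2 * D x)); first by ring.
  rewrite big_distrl /=; apply: eq_bigr => y _.
  have : ~~ (parent x y && parent y x).
    rewrite /parent; apply/negP => /andP[/andP[_ /eqP h] /andP[_ /eqP h']]; lia.
  rewrite adjacent_parent; case: (parent x y); case: (parent y x) => //= _; lia.
(* Exchange the names of the endpoints in the second half, so that x is the
   child and y its parent in both. *)
under eq_bigr do rewrite big_split.
rewrite big_split /= [X in _ + X]exchange_big /= -big_split /=.
apply: eq_bigr => x _; rewrite -big_split /=.
transitivity (\sum_y parent x y * (4 * D x)).
  apply: eq_bigr => y _; case pxy: (parent x y) => //.
  by case/andP: pxy => _ /eqP->; ring.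
rewrite -big_distrl /=.
by rewrite -card_sum_nat card_parent; case: (D x) => // n; rewrite mul1n.
Qed.

End Forest.

Local Open Scope ring_scope.

Theorem lemma4p1 (V : finType) (e : rel V) (hT : is_tree e) (i : V) :
  2 * (\sum_(j : V) (distance e i j)%:R) =
  2^-1 * (volume e)%:R + \sum_(j : V) (distance e i j)%:R * (degree e j)%:R
    :> rat.
Proof.
case: hT => [[e_sym e_irr] e_conn e_acyc].
have /(congr1 (fun n => n%:R : rat)) :=
  sum_distance_degree e_sym e_irr e_acyc e_conn i.
rewrite natrD !natrM -/(volume e) !natr_sum.
under [X in _ + _ * X = _ -> _]eq_bigr do rewrite natrM.
by move=> h; lra.
Qed.
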